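(* For every integer $n\ge 0$ there is a bijection $\varphi_n:\mathcal{DP}(n)\to\mathcal{MP}^*(n)$ from the set of area sequences of size $n$ to the set of bicolored Motzkin sequences of size $n$ with the following properties. If $\varphi_n(\mathbf a)=\mathbf w^*_{\mathbf a}$, and $\mathbf w_{\mathbf a}$ denotes the uncolored version of $\mathbf w^*_{\mathbf a}$, then (i) the peak-nesting vector of $\mathbf a$ is $\mathbf{pnv}(\mathbf a)=\mathbf w_{\mathbf a}$; (ii) $\mathrm{peak}(\mathbf a)=1+\mathrm{asc}(\mathbf w^*_{\mathbf a})+\mathrm{decor}(\mathbf w^*_{\mathbf a})$.
   Context: Write $[n]=\{1,\dots,n\}$. An area sequence of size $n$ is a sequence $\mathbf a=(a_1,\dots,a_n)$ of nonnegative integers with $a_i<i$ for all $i$ and $a_i\le a_{i-1}+1$ for all $i\ge 2$; $\mathcal{DP}(n)$ is the set of all of them (for $n=0$, only the empty sequence). Each $\mathbf a\in\mathcal{DP}(n)$ defines a graph $\Gamma_{\mathbf a}$ (a unit interval graph) on vertex set $[n]$ with edges $\{j,i\}$ for $1\le j<i\le n$ with $i-a_i\le j$. If $\{i,j\}$ with $i<j$ is an edge then $\{i,i+1,\dots,j\}$ is a clique. A peak-edge of $\Gamma_{\mathbf a}$ is either an isolated vertex $i$ (in which case put $j=i$) or an edge $\{i,j\}$, $i<j$, such that neither $\{i,j+1\}$ nor $\{i-1,j\}$ is an edge (pairs not contained in $[n]$ are not edges). The corresponding peak-clique is $\{i,i+1,\dots,j\}$. The number of peak-edges is $\mathrm{peak}(\mathbf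 a)$. The peak-nesting $\mathrm{pnest}(i)$ of a vertex $i$ is the number of peak-cliques containing $i$, and $\mathbf{pnv}(\mathbf a)=(\mathrm{pnest}(1),\dots,\mathrm{pnest}(n))$. A Motzkin sequence of size $n$ is a sequence $(w_1,\dots,w_n)$ of positive integers with $w_1=w_n=1$ and $|w_i-w_{i+1}|\le 1$ for $1\le i<n$ (for $n=0$, the empty sequence). An index $i\in[n-1]$ is an ascent if $w_i<w_{i+1}$ and a plateau if $w_i=w_{i+1}$. A bicolored Motzkin sequence is a Motzkin sequence in which each plateau is either marked with $*$ or not; $\mathcal{MP}^*(n)$ is the set of those of size $n$. The uncolored version is obtained by forgetting the marks. $\mathrm{asc}$ denotes the number of ascents (marks do not affect it) and $\mathrm{decor}$ the number of marked plateaus.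
   Formalization: Property (ii) is stated only for n ≥ 1, since at n = 0 the empty graph has no peak-edge, so peak = 0 while 1 + asc + decor = 1; the bijection and (i) are stated for all n ≥ 0. *)

(* Defs.v *)
From HB Require Import structures.
From mathcomp Require Import all_boot.

Set Implicit Arguments.
Unset Strict Implicit.
Unset Printing Implicit Defensive.

(* The index set [n] = {1, ..., n} is 'I_n: i : 'I_n stands for the 1-based
   index i.+1. *)

Definition consecutive n (i j : 'I_n) : bool := j == i.+1 :> nat.

(* The 1-based condition a_i < i reads a_i <= i with 0-based i. *)
Definition is_area_seq n (a : n.-tuple nat) : bool :=
  [forall i : 'I_n, tnth a i <= i] &&
  [forall i : 'I_n, forall j : 'I_n,
     consecutive i j ==> (tnth a j <= (tnth a i).+1)].

Definition DP n := {a : n.-tuple nat | is_area_seq a}.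

Section UnitIntervalGraph.
Variables (n : nat) (a : n.-tuple nat).

(* On area sequences the subtraction is never truncated; the condition
   i - a_i <= j is unchanged by the shift of indices. *)
Definition down_edge (i j : 'I_n) : bool := (j < i) && (i - tnth a i <= j).

Definition edge : rel 'I_n := fun i j => down_edge i j || down_edge j i.

Definition isolated (i : 'I_n) : bool := [forall k, ~~ edge i k].

(* A peak-edge is encoded by its ordered pair of endpoints (i, j), i <= j, with
   i = j for an isolated vertex. Quantifying over k : 'I_n makes the pairs
   {i, j+1} and {i-1, j} non-edges when they are not contained in [n]. *)
Definition peak_edges : {set 'I_n * 'I_n} :=
  [set e : 'I_n * 'I_n | (e.1 == e.2) && isolated e.1
           || [&& e.1 < e.2, edge e.1 e.2,
                  [forall k, consecutive e.2 k ==> ~~ edge e.1 k]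
                & [forall k, consecutive k e.1 ==> ~~ edge k e.2]]].

Definition peak : nat := #|peak_edges|.

Definition peak_cliques : {set {set 'I_n}} :=
  [set [set k : 'I_n | e.1 <= k <= e.2] | e : 'I_n * 'I_n in peak_edges].

Definition pnest (i : 'I_n) : nat := #|[set C in peak_cliques | i \in C]|.

Definition pnv : n.-tuple nat := [tuple pnest i | i < n].

End UnitIntervalGraph.

Definition is_motzkin n (w : n.-tuple nat) : bool :=
  [&& [forall i, 0 < tnth w i],
      [forall i : 'I_n, (i == 0 :> nat) || (i.+1 == n) ==> (tnth w i == 1)]
    & [forall i : 'I_n, forall j : 'I_n, consecutive i j ==>
         (tnth w i <= (tnth w j).+1) && (tnth w j <= (tnth w i).+1)]].

(* The last element of 'I_n has no successor in 'I_n, so the sets below only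
   contain indices from [n-1]. *)
Definition ascents n (w : n.-tuple nat) : {set 'I_n} :=
  [set i | [exists j, consecutive i j && (tnth w i < tnth w j)]].

Definition plateaus n (w : n.-tuple nat) : {set 'I_n} :=
  [set i | [exists j, consecutive i j && (tnth w i == tnth w j)]].

(* A bicolored Motzkin sequence is a Motzkin sequence paired with the set of
   its marked plateaus. *)
Definition MPstar n :=
  {w : n.-tuple nat * {set 'I_n} | is_motzkin w.1 && (w.2 \subset plateaus w.1)}.

Definition uncolored n (w : MPstar n) : n.-tuple nat := (val w).1.

Definition asc n (w : MPstar n) : nat := #|ascents (uncolored w)|.

Definition decor n (w : MPstar n) : nat := #|(val w).2|.

(* Main.v *)
(** Let l(i) = i - a_i, a nondecreasing map with l(i) <= i. The peak-cliques are
    the intervals [l(r), r] where r is a right end, i.e. r is the last vertex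
    or l(r) < l(r+1). Put A(i) = #{r right end | l(r) <= i} and
    B(i) = #{r right end | r < i} ([nleft] and [nright] below, or [nup] and
    [ndown] when read off a Motzkin sequence). Then pnest(i) = A(i) - B(i), the total number
    of peaks is A(n), and A and B grow by at most one at each step. A plateau of
    pnv at i, i+1 means that A and B either both grow or both stay, and marking
    it when both grow keeps enough information to recover A and B. These in
    turn determine l, because l(j) <= i if and only if B(j) < A(i). Conversely,
    a bicolored Motzkin sequence yields A and B, and this equivalence serves as
    the definition of l. *)

Require Import Defs.
From mathcomp Require Import all_boot.
From mathcomp Require Import zify.

Set Implicit Arguments.
Unset Strict Implicit.
Unset Printing Implicit Defensive.

(** * Counting by sums of booleans *)

Lemma sum_ltn_ord n m : \sum_(i < n) (i < m) = minn n m.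
Proof.
elim: n => [|n IHn]; first by rewrite big_ord0 min0n.
by rewrite big_ord_recr /= IHn; lia.
Qed.

Lemma sum_bool_card (T : finType) (p : pred T) : \sum_i p i = #|[set i | p i]|.
Proof.
by rewrite -sum1dep_card [RHS]big_mkcond; apply: eq_bigr => i _; case: (p i).
Qed.

(** Monotonicity makes the indices with [f k <= b] an initial segment, so the sum is the first index
    where [f] exceeds [b], capped at [n]. *)
Lemma leq_sum_leq (f : nat -> nat) n b i :
  {homo f : x y / x <= y} -> i < n ->
  (\sum_(k < n) (f k <= b) <= i) = (b < f i).
Proof.
move=> f_homo ltin; case: (ltnP b (f i)) => [ltbf | lefb].
- suff le: \sum_(k < n) (f k <= b) <= \sum_(k < n) (k < i).
    by rewrite sum_ltn_ord in le; lia.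
  by apply: leq_sum => k _; case: (leqP i k) => [/f_homo|]; lia.
- suff le: \sum_(k < n) (k < i.+1) <= \sum_(k < n) (f k <= b).
    by rewrite sum_ltn_ord in le; lia.
  by apply: leq_sum => k _; case: (leqP k i) => [/f_homo|]; lia.
Qed.

(** The inner sum numbers the elements of [p] in order from 0, so the first [c] of them are counted,
    or all if there are fewer. *)
Lemma sum_rank_lt (p : pred nat) m c :
  \sum_(r < m) (p r && (\sum_(k < r) p k < c)) = minn c (\sum_(k < m) p k).
Proof.
elim: m => [|m IHm]; first by rewrite !big_ord0 minn0.
by rewrite !big_ord_recr /= IHm; case: (p m) => /=; lia.
Qed.

(* When l n = n and l r <= r, the index n.-1 is a right end automatically. *)
Definition right_end (l : nat -> nat) r := l r < l r.+1.

Definition nright l i := \sum_(r < i) right_end l r.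

Definition nleft l n i := \sum_(r < n) (right_end l r && (l r <= i)).

Lemma homo_leqS (f : nat -> nat) :
  (forall i, f i <= f i.+1) -> {homo f : i j / i <= j}.
Proof. by move=> fS; apply: homo_leq => // ? ? ?; exact: leq_trans. Qed.

Lemma nrightS l i : nright l i.+1 = nright l i + right_end l i.
Proof. by rewrite /nright big_ord_recr. Qed.

Lemma nright_homo l : {homo nright l : i j / i <= j}.
Proof. by apply: homo_leqS => i; rewrite nrightS leq_addr. Qed.

Lemma nleft_homo l n : {homo nleft l n : i j / i <= j}.
Proof.
move=> i j leij; apply: leq_sum => r _.
by case: (right_end l r) => //=; lia.
Qed.

(** * Right ends of a nondecreasing map below the identity *)

Section LeftEndpoints.
Variables (n : nat) (l : nat -> nat).
Hypothesis l_le : forall i, l i <= i.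
Hypothesis l_homo : {homo l : i j / i <= j}.
Hypothesis l_n : l n = n.
(* [lia] would otherwise pull an arbitrary subset of the hypotheses into each
   proof, hence into the statements after the section. *)
Set Default Proof Using "All".

(** The least [m] with [l j < l m] exists because [l j <= j < n = l n]; its predecessor ends the run
    on which [l] keeps the value [l j]. *)
Lemma next_right_end j : j < n -> exists r, [/\ j <= r, r < n, right_end l r & l r = l j].
Proof.
move=> ltjn; have exm: exists m, l j < l m by exists n; have := l_le j; lia.
case: (ex_minnP exm) => -[|r] ltlm minm; first by have := l_homo (leq0n j); lia.
have lejr: j <= r by case: (leqP r.+1 j) => [/l_homo|]; lia.
have lerl: l r <= l j by case: (leqP (l r) (l j)) => // /minm; lia.
have eql: l r = l j by have := l_homo lejr; lia.
exists r; split=> //; last by rewrite /right_end eql.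
by have := minm n; have := l_le j; lia.
Qed.

(** If [l j > i], every right end [r] with [l r <= i] lies before [j]. If [l j <= i], [nleft] counts
    all right ends before [j] and also the next one, at or after [j], where [l] still equals
    [l j]. *)
Lemma left_leq i j : j < n -> (l j <= i) = (nright l j < nleft l n i).
Proof.
move=> ltjn; case: (leqP (l j) i) => [leli | ltil]; symmetry; last first.
  apply/negbTE; rewrite -leqNgt /nright /nleft.
  rewrite (big_ord_widen _ (fun r => right_end l r : nat) (ltnW ltjn)).
  rewrite [leqRHS]big_mkcond leq_sum // => r _.
  by case: (ltnP r j) => [_ | /l_homo]; case: (right_end l r) => /=; lia.
have [r [lejr ltrn Rr eql]] := next_right_end ltjn.
apply: leq_ltn_trans (nright_homo l lejr) _.
suff: nright l r.+1 <= nleft l n i by rewrite nrightS Rr addn1.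
rewrite /nright /nleft (big_ord_widen _ (fun r => right_end l r : nat) ltrn).
rewrite big_mkcond leq_sum // => k _.
by case: (ltnP k r.+1) => // lekr; case: (right_end l k) => //=;
   have := l_homo (lekr : k <= r); lia.
Qed.

Lemma right_end_inj r r' : right_end l r -> right_end l r' -> l r = l r' -> r = r'.
Proof.
rewrite /right_end => Rr Rr' eql.
by case: (ltngtP r r') => // /l_homo; lia.
Qed.

Lemma sum_right_end_le1 x : \sum_(r < n) (right_end l r && (l r == x)) <= 1.
Proof.
rewrite (sum_bool_card (fun r : 'I_n => right_end l r && (l r == x))).
apply/card_le1_eqP => r r'; rewrite !inE => /andP[Rr /eqP lr] /andP[Rr' /eqP lr'].
by apply/val_inj/right_end_inj; rewrite ?lr ?lr'.
Qed.

Lemma nleftS i : nleft l n i.+1 <= (nleft l n i).+1.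
Proof.
rewrite -[leqRHS]addn1; apply: leq_trans _ (leq_add (leqnn _) (sum_right_end_le1 i.+1)).
rewrite -big_split leq_sum // => r _.
by case: (right_end l r) => //=; lia.
Qed.

Lemma nleft0 : nleft l n 0 <= 1.
Proof.
apply: leq_trans _ (sum_right_end_le1 0); apply: leq_sum => r _.
by rewrite leqn0.
Qed.

Lemma nleft_last : nleft l n n.-1 = nright l n.
Proof.
apply: eq_bigr => r _; suff -> : l r <= n.-1 by rewrite andbT.
by have := l_le r; have := ltn_ord r; lia.
Qed.

(** Right ends before [i] satisfy [l r <= i] automatically; the others counted by [nleft] are those
    whose interval contains [i]. *)
Lemma nleft_nright i : i < n ->
  \sum_(r < n) (right_end l r && (l r <= i <= r)) + nright l i = nleft l n i.
Proof.
move=> ltin; rewrite /nright (big_ord_widen _ (fun r => right_end l r : nat) (ltnW ltin)).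
rewrite [X in _ + X]big_mkcond -big_split; apply: eq_bigr => r _ /=.
by case: ltnP => [|_]; case: (right_end l r) => //=; have := l_le r; lia.
Qed.

Unset Default Proof Using.

End LeftEndpoints.

(* W is padded with W n = 0, so that the last index counts as a descent. *)
Definition up (W : nat -> nat) (s : pred nat) k := (W k < W k.+1) || s k.

Definition down (W : nat -> nat) (s : pred nat) k := (W k.+1 < W k) || s k.

(* The initial 1 accounts for the clique starting at the first vertex. *)
Definition nup W s i := (\sum_(k < i) up W s k).+1.

Definition ndown W s i := \sum_(k < i) down W s k.

(* The least i with [ndown W s j < nup W s i]. *)
Definition left_end n W s j := \sum_(i < n) (nup W s i <= ndown W s j).

Lemma nupS W s i : nup W s i.+1 = nup W s i + up W s i.
Proof. by rewrite /nup big_ord_recr addSn. Qed.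

Lemma ndownS W s i : ndown W s i.+1 = ndown W s i + down W s i.
Proof. by rewrite /ndown big_ord_recr. Qed.

Lemma nup0 W s : nup W s 0 = 1.
Proof. by rewrite /nup big_ord0. Qed.

Lemma ndown0 W s : ndown W s 0 = 0.
Proof. by rewrite /ndown big_ord0. Qed.

Lemma nup_homo W s : {homo nup W s : i j / i <= j}.
Proof. by apply: homo_leqS => i; rewrite nupS leq_addr. Qed.

Lemma ndown_homo W s : {homo ndown W s : i j / i <= j}.
Proof. by apply: homo_leqS => i; rewrite ndownS leq_addr. Qed.

Lemma left_end_homo n W s : {homo left_end n W s : i j / i <= j}.
Proof.
move=> i j /ndown_homo le_ij; apply: leq_sum => k _.
by case: (leqP (nup W s k) (ndown W s i)) => // /leq_trans -> //.
Qed.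

Lemma left_end_max n W s j : left_end n W s j <= n.
Proof.
rewrite -[leqRHS]muln1 -[X in X * 1]card_ord -sum_nat_const.
by apply: leq_sum => k _; exact: leq_b1.
Qed.

(** * Recovering the left endpoints from a path *)

Section Reconstruction.
Variables (n : nat) (l : nat -> nat) (W : nat -> nat) (s : pred nat).
Hypothesis l_le : forall i, l i <= i.
Hypothesis l_homo : {homo l : i j / i <= j}.
Hypothesis l_n : l n = n.
Hypothesis W_l : forall i, i < n -> W i + nright l i = nleft l n i.
Hypothesis s_l : forall i, i.+1 < n -> s i = right_end l i && (W i == W i.+1).

(** Both counts grow by at most one per step and differ by [W]: at an ascent only [nleft] grows, at
    a descent only [nright], and on a plateau [s] tells whether both do. *)
Lemma nup_ndown_reconstruct i :
  i < n -> nup W s i = nleft l n i /\ ndown W s i = nright l i.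
Proof.
elim: i => [|i IHi] ltin.
  rewrite nup0 ndown0 /nright big_ord0; split=> //.
  (* Since [l 0 <= 0], [left_leq] makes the count positive, and [nleft0] caps it at 1. *)
  by have := left_leq l_le l_homo l_n 0 ltin;
     have := nleft0 l_le l_homo l_n; have := l_le 0; lia.
have {IHi} [eqA eqB] := IHi (ltnW ltin).
have := W_l (ltnW ltin); have := W_l ltin; have := s_l ltin.
have := nleft_homo l n (leqnSn i); have := nleftS l_le l_homo l_n i.
rewrite nupS ndownS nrightS /up /down.
case: (right_end l i) => /= ? ? ->; lia.
Qed.

Lemma left_end_reconstruct j : j < n -> left_end n W s j = l j.
Proof.
move=> ltjn; rewrite /left_end.
(* By [left_leq], the condition on [i] in the sum amounts to [i < l j]. *)
rewrite (eq_bigr (fun i : 'I_n => (i < l j : nat))) => [|i _].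
  by rewrite sum_ltn_ord; apply/minn_idPr; rewrite (leq_trans (l_le j)) // ltnW.
have [-> _] := nup_ndown_reconstruct (ltn_ord i).
have [_ ->] := nup_ndown_reconstruct ltjn.
by rewrite leqNgt -(left_leq l_le l_homo l_n) // -ltnNge.
Qed.

End Reconstruction.

(* Equal to i for i >= n, since [nth] then returns 0. *)
Definition clique_left n (a : n.-tuple nat) i := i - nth 0 a i.

Lemma clique_left_le n (a : n.-tuple nat) i : clique_left a i <= i.
Proof. exact: leq_subr. Qed.

Lemma clique_left_n n (a : n.-tuple nat) : clique_left a n = n.
Proof. by rewrite /clique_left nth_default ?size_tuple ?subn0. Qed.

Lemma clique_left_homo n (a : n.-tuple nat) :
  is_area_seq a -> {homo clique_left a : i j / i <= j}.
Proof.
move=> /andP[_ /forallP a_step]; apply: homo_leqS => i.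
case: (ltnP i.+1 n) => [ltSin | leni]; last first.
  by rewrite {2}/clique_left nth_default ?size_tuple // subn0 (leq_trans (clique_left_le a i)).
have := forallP (a_step (Ordinal (ltnW ltSin))) (Ordinal ltSin).
by rewrite /consecutive eqxx !(tnth_nth 0) /clique_left /=; lia.
Qed.

Lemma is_area_seq_mktuple n (l : nat -> nat) :
  (forall i, l i <= i) -> {homo l : i j / i <= j} ->
  is_area_seq [tuple i - l i | i < n].
Proof.
move=> l_le l_homo; apply/andP; split; apply/forallP => i.
  by rewrite tnth_mktuple leq_subr.
apply/forallP => j; apply/implyP => /eqP ij; rewrite !tnth_mktuple ij.
by have := l_homo i i.+1 (leqnSn i); have := l_le i; lia.
Qed.

Lemma clique_left_mktuple n (l : nat -> nat) j :
  (forall i, l i <= i) -> j < n -> clique_left [tuple i - l i | i < n] j = l j.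
Proof.
move=> l_le ltjn; rewrite /clique_left -(tnth_nth 0 _ (Ordinal ltjn)) tnth_mktuple /=.
by rewrite subKn.
Qed.

(** * Peak-cliques as intervals ending at right ends *)

Section Peaks.
Variables (n : nat) (a : n.-tuple nat).
Hypothesis a_area : is_area_seq a.
Let l := clique_left a.
Let l_le : forall i, l i <= i := clique_left_le a.
Let l_homo : {homo l : i j / i <= j} := clique_left_homo a_area.
Let l_n : l n = n := clique_left_n a.

Definition clique_left_ord (j : 'I_n) : 'I_n :=
  Ordinal (leq_ltn_trans (clique_left_le a j) (ltn_ord j)).

Lemma edge_lt (i j : 'I_n) : i < j -> edge a i j = (l j <= i).
Proof.
move=> ltij; rewrite /edge /down_edge ltij !(tnth_nth 0) -/(clique_left a j).
by rewrite ltnNge ltnW.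
Qed.

Lemma edgeC (i j : 'I_n) : edge a i j = edge a j i.
Proof. exact: orbC. Qed.

Lemma right_end_ord (j : 'I_n) :
  right_end l j = [forall k, consecutive j k ==> (l j < l k)].
Proof.
apply/idP/forallP => [Rj k | Rj]; first by apply/implyP => /eqP ->.
case: (ltnP j.+1 n) => [ltjn | lenj].
  by have := Rj (Ordinal ltjn); rewrite /consecutive eqxx.
have ejn : j.+1 = n by apply/eqP; rewrite eqn_leq lenj ltn_ord.
by rewrite /right_end ejn l_n (leq_ltn_trans (l_le j)).
Qed.

Lemma isolatedE (j : 'I_n) : isolated a j = (l j == j) && right_end l j.
Proof.
apply/forallP/andP => [iso | [/eqP lj Rj] k].
  have lj : l j = j.
    apply/eqP; rewrite eqn_leq l_le leqNgt; apply/negP => ltlj.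
    have := iso (clique_left_ord j); rewrite edgeC edge_lt //=.
    by rewrite leqnn.
  rewrite lj eqxx right_end_ord; split=> //; apply/forallP => k; apply/implyP => /eqP jk.
  by have := iso k; rewrite edge_lt jk // lj -ltnNge.
case: (ltngtP j k) => [ltjk | ltkj | /val_inj <-].
- rewrite edge_lt // -ltnNge -[ltnLHS]lj; apply: leq_trans Rj _; exact: l_homo.
- by rewrite edgeC edge_lt // lj -ltnNge.
- by rewrite /edge /down_edge ltnn.
Qed.

(** An edge from [i] to a larger [j] cannot be extended to the left exactly when [i = l j], and then
    not to the right exactly when [j] is a right end. Isolated vertices are the right ends with
    [l j = j]. *)
Lemma peak_edgesE : peak_edges a =
  [set (clique_left_ord j, j) | j in [set j : 'I_n | right_end l j]].
Proof.
apply/setP => -[i j]; rewrite inE /=.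
have -> : ((i, j) \in [set (clique_left_ord j, j) | j in [set j : 'I_n | right_end l j]])
          = (i == clique_left_ord j) && right_end l j.
  apply/imsetP/andP => [[k] | [/eqP -> Rj]]; first by rewrite inE => Rk [-> ->].
  by exists j; rewrite ?inE.
rewrite isolatedE -val_eqE -[i == clique_left_ord j]val_eqE /= -/l.
case: (ltngtP i j) => [ltij | ltji | /val_inj <-] /=; last 1 first.
- by rewrite orbF eq_sym andbC; case: eqP; rewrite ?andbF.
- rewrite edge_lt // right_end_ord.
  apply/and3P/andP => [[leli /forallP nxt /forallP prv] | [/eqP eqi /forallP nxt]].
    have eqi : i = l j :> nat.
      apply/eqP; rewrite eqn_leq leli andbT; case E: (nat_of_ord i) => [|i'] //.
      have lti' : i' < n by have := ltn_ord i; rewrite E; lia.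
      have := prv (Ordinal lti'); rewrite /consecutive /= E eqxx edge_lt /= -/l; lia.
    split; first exact/eqP; apply/forallP => k; apply/implyP => jk.
    have := nxt k; rewrite jk edge_lt -?eqi -?ltnNge //.
    by rewrite (eqP jk); lia.
  split; first by rewrite eqi.
    apply/forallP => k; apply/implyP => jk.
    rewrite edge_lt /=; last by rewrite (eqP jk) ltnS ltnW.
    by rewrite -ltnNge eqi; have := nxt k; rewrite jk.
  apply/forallP => k; apply/implyP => /eqP ki; rewrite edge_lt; last by lia.
  by rewrite -ltnNge -/l -eqi ki.
- by symmetry; apply/negbTE/negP => /andP[/eqP eqi _]; have := l_le j; lia.
Qed.

Lemma peakE : peak a = nright l n.
Proof.
rewrite /peak peak_edgesE card_imset => [|j k []] //.
by rewrite /nright (sum_bool_card (fun r : 'I_n => right_end l r)).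
Qed.

(** A clique determines its right end as its maximum, so counting cliques amounts to counting right
    ends. *)
Lemma pnestE (i : 'I_n) :
  pnest a i = \sum_(r < n) (right_end l r && (l r <= i <= r)).
Proof.
pose clique (j : 'I_n) := [set k : 'I_n | l j <= k <= j].
have clique_inj : injective clique.
  move=> j k eq_jk; apply/val_inj/eqP; rewrite eqn_leq /=.
  have : j \in clique k by rewrite -eq_jk inE l_le leqnn.
  have : k \in clique j by rewrite eq_jk inE l_le leqnn.
  by rewrite !inE => /andP[_ ->] /andP[_ ->].
rewrite (sum_bool_card (fun r : 'I_n => right_end l r && (l r <= i <= r))).
rewrite -(card_imset _ clique_inj) /pnest /peak_cliques peak_edgesE -imset_comp.
congr #|pred_of_set _|; apply/setP => C; rewrite inE.
apply/andP/imsetP => [[/imsetP[j]] | [j]]; rewrite inE.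
  by move=> Rj ->; rewrite inE /= => lij; exists j; rewrite ?inE ?Rj.
move=> /andP[Rj lij] ->; split; last by rewrite inE.
by apply/imsetP; exists j; rewrite ?inE.
Qed.

Lemma nth_pnv i : i < n -> nth 0 (pnv a) i + nright l i = nleft l n i.
Proof.
move=> ltin; rewrite -(tnth_nth 0 _ (Ordinal ltin)) tnth_mktuple pnestE.
exact: nleft_nright.
Qed.

(** Positivity is [left_leq] at [j = i]. The end values are 1 because [nleft] is at most 1 at the
    first vertex and equals [nright l n] at the last; steps are bounded because both counts grow by
    at most one. *)
Lemma pnv_motzkin : is_motzkin (pnv a).
Proof.
have pnv_ord (i : 'I_n) : tnth (pnv a) i + nright l i = nleft l n i.
  by rewrite (tnth_nth 0) nth_pnv.
apply/and3P; split; apply/forallP => i.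
- have := left_leq l_le l_homo l_n i (ltn_ord i); rewrite l_le.
  by have := pnv_ord i; lia.
- apply/implyP => i_end; have := pnv_ord i.
  have := left_leq l_le l_homo l_n i (ltn_ord i); rewrite l_le => /esym.
  case/orP: i_end => /eqP i_end.
    rewrite i_end /nright big_ord0; have := nleft0 l_le l_homo l_n; lia.
  have := nleft_last l_le l_homo l_n; rewrite -{2 3}i_end nrightS /=.
  by case: (right_end l i); lia.
- apply/forallP => j; apply/implyP => /eqP ij; have := pnv_ord i; have := pnv_ord j.
  rewrite ij nrightS; have := nleft_homo l n (leqnSn i).
  by have := nleftS l_le l_homo l_n i; case: (right_end l i); lia.
Qed.

End Peaks.

(** * Motzkin sequences padded with zeros *)

Section Motzkin.
Variables (n : nat) (w : n.-tuple nat).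
Hypothesis w_motzkin : is_motzkin w.

Lemma nth_motzkin_gt0 i : i < n -> 0 < nth 0 w i.
Proof.
move=> ltin; have /and3P[/forallP/(_ (Ordinal ltin)) + _ _] := w_motzkin.
by rewrite (tnth_nth 0).
Qed.

Lemma nth_motzkin_end i : i < n -> (i == 0) || (i.+1 == n) -> nth 0 w i = 1.
Proof.
move=> ltin i_end; have /and3P[_ /forallP/(_ (Ordinal ltin)) + _] := w_motzkin.
by rewrite (tnth_nth 0) /= i_end => /eqP.
Qed.

(** The padding value 0 past the end is one step below the last entry, which is 1. *)
Lemma nth_motzkin_step i :
  (nth 0 w i <= (nth 0 w i.+1).+1) && (nth 0 w i.+1 <= (nth 0 w i).+1).
Proof.
case: (ltnP i.+1 n) => [ltin | leni].
  have /and3P[_ _ /forallP/(_ (Ordinal (ltnW ltin)))] := w_motzkin.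
  move=> /forallP/(_ (Ordinal ltin)).
  by rewrite /consecutive eqxx !(tnth_nth 0).
rewrite [nth 0 w i.+1]nth_default ?size_tuple // andbT.
case: (ltnP i n) => [ltin | leni']; last by rewrite nth_default ?size_tuple.
by rewrite nth_motzkin_end // orbC eqn_leq ltin leni.
Qed.

Lemma mem_plateaus (i : 'I_n) :
  (i \in plateaus w) = (i.+1 < n) && (nth 0 w i == nth 0 w i.+1).
Proof.
rewrite inE; apply/existsP/andP => [[j /andP[/eqP ij]] | [ltin eqw]].
  by rewrite !(tnth_nth 0) -ij ltn_ord.
by exists (Ordinal ltin); rewrite /consecutive eqxx !(tnth_nth 0).
Qed.

Lemma mem_ascents (i : 'I_n) : (i \in ascents w) = (nth 0 w i < nth 0 w i.+1).
Proof.
rewrite inE; apply/existsP/idP => [[j /andP[/eqP ij]] | ltw].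
  by rewrite !(tnth_nth 0) -ij.
have ltin : i.+1 < n.
  rewrite ltnNge; apply: contraL ltw => lein.
  by rewrite [nth 0 w i.+1]nth_default ?size_tuple.
by exists (Ordinal ltin); rewrite /consecutive eqxx !(tnth_nth 0).
Qed.

End Motzkin.

Definition marked n (S : {set 'I_n}) (k : nat) := k \in image val S.

Lemma marked_ord n (S : {set 'I_n}) (i : 'I_n) : marked S i = (i \in S).
Proof. exact/mem_image/val_inj. Qed.

Section Paths.
Variable n : nat.

Definition pathW (x : MPstar n) : nat -> nat := nth 0 (uncolored x).

Definition pathS (x : MPstar n) : pred nat := marked (val x).2.

Lemma pathS_plateau x i : pathS x i -> pathW x i = pathW x i.+1.
Proof.
case/imageP => j jS ->; have /andP[_ /subsetP/(_ _ jS)] := valP x.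
by rewrite mem_plateaus => /andP[_ /eqP].
Qed.

Lemma uncolored_motzkin (x : MPstar n) : is_motzkin (uncolored x).
Proof. by have /andP[] := valP x. Qed.

Lemma pathW_step x i :
  (pathW x i <= (pathW x i.+1).+1) && (pathW x i.+1 <= (pathW x i).+1).
Proof. exact/nth_motzkin_step/uncolored_motzkin. Qed.

Lemma pathW_gt0 x i : i < n -> 0 < pathW x i.
Proof. exact/nth_motzkin_gt0/uncolored_motzkin. Qed.

Lemma pathW_n x : pathW x n = 0.
Proof. by rewrite /pathW nth_default ?size_tuple. Qed.

Lemma pathW0 x : 0 < n -> pathW x 0 = 1.
Proof. by move=> n_gt0; rewrite /pathW nth_motzkin_end // uncolored_motzkin. Qed.

End Paths.

(** * Left endpoints built from a bicolored sequence *)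

Section MotzkinPaths.
Variables (n : nat) (x : MPstar n).
Hypothesis n_gt0 : 0 < n.

Local Notation W := (pathW x).
Local Notation s := (pathS x).

(** An ascent feeds only [nup], a descent only [ndown], a marked plateau both, an unmarked one
    neither. *)
Lemma nup_ndown i : nup W s i = ndown W s i + W i.
Proof.
elim: i => [|i IHi]; first by rewrite nup0 ndown0 pathW0.
rewrite nupS ndownS IHi /up /down; have /andP[] := pathW_step x i.
by case: (boolP (s i)) => [/pathS_plateau|_]; lia.
Qed.

Lemma nup_last : nup W s n.-1 = nup W s n.
Proof.
have := nupS W s n.-1; rewrite prednK // => ->; rewrite /up prednK // pathW_n ltn0.
(* A mark at the last index would force its entry to equal the padding value 0. *)
case: (boolP (s n.-1)) => [/pathS_plateau|_]; last by rewrite addn0.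
by rewrite prednK // pathW_n; have := pathW_gt0 x (i := n.-1); lia.
Qed.

Lemma left_end_leq i j :
  i < n -> (left_end n W s j <= i) = (ndown W s j < nup W s i).
Proof. exact/leq_sum_leq/nup_homo. Qed.

Lemma left_end_n : left_end n W s n = n.
Proof.
rewrite /left_end (eq_bigr (fun i : 'I_n => (i < n : nat))) ?sum_ltn_ord ?minnn //.
move=> i _; have -> : nup W s i <= ndown W s n.
  by rewrite -[ndown _ _ _]addn0 -(pathW_n x) -nup_ndown nup_homo // ltnW.
by rewrite ltn_ord.
Qed.

Lemma left_end_le j : left_end n W s j <= j.
Proof.
case: (ltnP j n) => [ltjn | lenj].
  by rewrite left_end_leq // nup_ndown -[ltnLHS]addn0 ltn_add2l pathW_gt0.
exact: leq_trans (left_end_max _ _ _ _) lenj.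
Qed.

(** Without a down step, [ndown] and hence [left_end] stay put. At a down step, [nup] just before
    [left_end] is at most the old [ndown], so at [left_end] it is at most the new one, and
    [left_end] must move. *)
Lemma right_end_left_end k : k < n -> right_end (left_end n W s) k = down W s k.
Proof.
move=> ltkn; rewrite /right_end ltnNge.
have ltln : left_end n W s k < n by apply: leq_ltn_trans ltkn; exact: left_end_le.
rewrite left_end_leq // ndownS.
case: (down W s k); last by rewrite addn0 -left_end_leq // leqnn.
rewrite -leqNgt addn1; apply/idP.
case E: (left_end n W s k) => [|i]; first by rewrite nup0.
suff : nup W s i <= ndown W s k by rewrite nupS; case: (up W s i); lia.
by rewrite leqNgt -left_end_leq ?E ?ltnn //; lia.
Qed.

Lemma nright_left_end i : i <= n -> nright (left_end n W s) i = ndown W s i.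
Proof.
move=> lein; apply: eq_bigr => k _; rewrite right_end_left_end //.
exact: leq_trans lein.
Qed.

(** The right ends are the down steps, and [ndown] is their rank: those of rank below [nup W s i]
    are counted. There are enough of them since [ndown] catches up with [nup] at [n]. *)
Lemma nleft_left_end i : i < n -> nleft (left_end n W s) n i = nup W s i.
Proof.
move=> ltin; rewrite /nleft.
under eq_bigr => r _ do rewrite left_end_leq // right_end_left_end //.
rewrite sum_rank_lt; apply/minn_idPl.
rewrite -/(ndown W s n) -[ndown _ _ _]addn0 -(pathW_n x) -nup_ndown.
by rewrite nup_homo // ltnW.
Qed.

End MotzkinPaths.

(** * The two mutually inverse maps and the peak count *)

Section Bijection.
Variable n : nat.

Definition right_plateaus (a : n.-tuple nat) : {set 'I_n} :=
  [set i in plateaus (pnv a) | right_end (clique_left a) i].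

Lemma MP_of_subproof (a : DP n) :
  is_motzkin (pnv (val a)) && (right_plateaus (val a) \subset plateaus (pnv (val a))).
Proof. by rewrite pnv_motzkin ?(valP a) //; apply/subsetP => i; rewrite inE => /andP[]. Qed.

Definition MP_of (a : DP n) : MPstar n :=
  exist _ (pnv (val a), right_plateaus (val a)) (MP_of_subproof a).

Definition path_left (x : MPstar n) := left_end n (pathW x) (pathS x).

Lemma path_left_le x i : path_left x i <= i.
Proof.
case: (posnP n) => [n0 | n_gt0]; last exact: left_end_le.
by apply: leq_trans (left_end_max _ _ _ _) _; rewrite {1}n0.
Qed.

Lemma path_left_homo x : {homo path_left x : i j / i <= j}.
Proof. exact: left_end_homo. Qed.

Definition DP_of (x : MPstar n) : DP n :=
  exist _ [tuple i - path_left x i | i < n]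
    (is_area_seq_mktuple n (path_left_le x) (@path_left_homo x)).

Lemma right_plateaus_marked (a : DP n) i : i.+1 < n ->
  pathS (MP_of a) i =
  right_end (clique_left (val a)) i && (pathW (MP_of a) i == pathW (MP_of a) i.+1).
Proof.
move=> ltin; rewrite /pathS -/(nat_of_ord (Ordinal (ltnW ltin))) marked_ord.
by rewrite inE mem_plateaus ltin andbC.
Qed.

Lemma MP_ofK : cancel MP_of DP_of.
Proof.
move=> a; apply/val_inj/eq_from_tnth => i; rewrite tnth_mktuple.
rewrite /path_left (left_end_reconstruct (l := clique_left (val a))) //.
- rewrite subKn -?tnth_nth //.
  by have /andP[/forallP/(_ i)] := valP a; rewrite (tnth_nth 0).
- exact: clique_left_le.
- exact/clique_left_homo/valP.
- exact: clique_left_n.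
- by move=> k; exact/nth_pnv/valP.
- exact: right_plateaus_marked.
Qed.

Lemma clique_left_DP_of x j : j <= n -> clique_left (val (DP_of x)) j = path_left x j.
Proof.
rewrite leq_eqVlt => /predU1P[-> | ltjn]; last exact/clique_left_mktuple/ltjn/path_left_le.
rewrite clique_left_n; case: (posnP n) => [n0 | n_gt0]; last by rewrite /path_left left_end_n.
by have := path_left_le x n; lia.
Qed.

Lemma right_end_DP_of x k : k < n ->
  right_end (clique_left (val (DP_of x))) k = right_end (path_left x) k.
Proof. by move=> ltkn; rewrite /right_end !clique_left_DP_of // ltnW. Qed.

Lemma pnv_DP_of x : pnv (val (DP_of x)) = uncolored x.
Proof.
apply: eq_from_tnth => i; rewrite !(tnth_nth 0) -/(pathW x i).
have n_gt0 : 0 < n by have := ltn_ord i; lia.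
have := nth_pnv (valP (DP_of x)) (ltn_ord i).
have -> : nright (clique_left (val (DP_of x))) i = nright (path_left x) i.
  apply: eq_bigr => k _; rewrite right_end_DP_of //.
  exact: ltn_trans (ltn_ord k) (ltn_ord i).
have -> : nleft (clique_left (val (DP_of x))) n i = nleft (path_left x) n i.
  by apply: eq_bigr => k _; rewrite right_end_DP_of // clique_left_DP_of // ltnW.
rewrite /path_left nright_left_end ?nleft_left_end // 1?ltnW //.
by rewrite nup_ndown // addnC => /addnI.
Qed.

Lemma DP_ofK : cancel DP_of MP_of.
Proof.
move=> x; apply/val_inj; rewrite /= [RHS]surjective_pairing.
congr (_, _); first exact: pnv_DP_of.
apply/setP => i; rewrite -[RHS]marked_ord -/(pathS x) inE mem_plateaus pnv_DP_of.
have n_gt0 : 0 < n by have := ltn_ord i; lia.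
rewrite right_end_DP_of // /path_left right_end_left_end // /down -/(pathW x).
(* An unmarked [down] is a strict descent, hence no plateau; a marked index is a plateau and, its
   entry being positive, not the last index. *)
case: (boolP (pathS x i)) => [Si | _]; last first.
  by rewrite orbF; case: eqP => [->|_]; rewrite ?ltnn ?andbF.
rewrite orbT andbT (pathS_plateau Si) eqxx andbT ltnNge.
apply/negP => lein; have := pathS_plateau Si; have := pathW_gt0 x (ltn_ord i).
by rewrite /pathW [nth 0 _ i.+1]nth_default ?size_tuple // => /lt0n_neq0/eqP.
Qed.

(** Every peak-clique has started by the last vertex, so the peaks are counted by [nup], whose
    increments are the ascents and the marks. *)
Lemma peak_MP_of (a : DP n) : 0 < n ->
  peak (val a) = 1 + asc (MP_of a) + decor (MP_of a).
Proof.
move=> n_gt0; have l_le := clique_left_le (val a); have l_homo := clique_left_homo (valP a).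
have l_n := clique_left_n (val a); set x := MP_of a.
have [eq_nup _] : nup (pathW x) (pathS x) n.-1 = nleft (clique_left (val a)) n n.-1 /\
                  ndown (pathW x) (pathS x) n.-1 = nright (clique_left (val a)) n.-1.
  apply: (nup_ndown_reconstruct l_le l_homo l_n) => [i ltin | i ltin |].
  - exact/nth_pnv/ltin/valP.
  - exact: right_plateaus_marked.
  - by rewrite prednK.
rewrite peakE ?(valP a) // -(nleft_last l_le l_homo l_n) -eq_nup nup_last //.
rewrite /nup -addn1 [LHS]addnC -addnA; congr (1 + _).
rewrite /asc /decor.
rewrite (_ : #|ascents _| = \sum_(k < n) (pathW x k < pathW x k.+1)); last first.
  by rewrite sum_bool_card; apply: eq_card => i; rewrite mem_ascents inE.
rewrite (_ : #|(val x).2| = \sum_(k < n) pathS x k); last first.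
  by rewrite sum_bool_card; apply: eq_card => i; rewrite [RHS]inE; exact: esym (marked_ord _ _).
rewrite -big_split; apply: eq_bigr => k _ /=; rewrite /up.
(* Marks sit on plateaus, so no index is both marked and an ascent. *)
by case: (boolP (pathS x k)) => [/pathS_plateau ->|]; rewrite ?ltnn ?orbF ?addn0.
Qed.

End Bijection.

Theorem theorem3p8 (n : nat) :
  exists phi : DP n -> MPstar n,
    bijective phi /\
    forall a : DP n,
      pnv (val a) = uncolored (phi a) /\
      (0 < n -> peak (val a) = 1 + asc (phi a) + decor (phi a)).
Proof.
exists (@MP_of n); split; first by exists (@DP_of n); [exact: MP_ofK | exact: DP_ofK].
by move=> a; split; last exact: peak_MP_of.
Qed.
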